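(* Let $(X,\tau)$ be an uncountable Polish space, let $f:X\to\mathbb{R}$ be a Baire class $1$ function and let $F\subseteq X$ be closed. Then $\alpha(f\cdot\chi_F)\le 1+\alpha(f)$, $\beta(f\cdot\chi_F)\le 1+\beta(f)$ and $\gamma(f\cdot\chi_F)\le 1+\gamma(f)$.
   Context: $\chi_F$ is the characteristic function of $F$; ordinal addition is used. A derivative on the closed subsets of $X$ is a map $D$ from closed sets to closed sets with $D(A)\subseteq A$ and $A\subseteq B\Rightarrow D(A)\subseteq D(B)$. Iterates: $D^0(F)=F$, $D^{\eta+1}(F)=D(D^\eta(F))$, $D^\eta(F)=\bigcap_{\theta<\eta}D^\theta(F)$ for limit $\eta$. The rank $\mathrm{rk}(D)$ is the least $\eta$ with $D^\eta(X)=\emptyset$ ($\omega_1$ if none). $\alpha$: $D_{A,B}(F)=\overline{F\cap A}\cap\overline{F\cap B}$, $\alpha(A,B)=\mathrm{rk}(D_{A,B})$, $\alpha(f)=\sup\{\alpha(\{f\le p\},\{f\ge q\}):p<q \text{ rational}\}$. $\beta$: $\omega(f,x,F)=\inf\{\sup_{x_1,x_2\in U\cap F}|f(x_1)-f(x_2)|:U\ni x\text{ open}\}$, $D_{f,\varepsilon}(F)=\{x\in F:\omega(f,x,F)\ge\varepsilon\}$, $\beta(f)=\sup_{\varepsilon>0}\mathrm{rk}(D_{f,\varepsilon})$. $\gamma$: for continuous $f_n$, $\omega((f_n),x,F)=\inf_{U\ni x\text{ open}}\inf_N\sup\{|f_m(y)-f_n(y)|:n,m\ge N,y\in U\cap F\}$,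 $D_{(f_n),\varepsilon}(F)=\{x\in F:\omega((f_n),x,F)\ge\varepsilon\}$, and $\gamma(f)=\min\{\sup_{\varepsilon>0}\mathrm{rk}(D_{(f_n),\varepsilon}): f_n\text{ continuous}, f_n\to f\text{ pointwise}\}$. *)

(* Defs.v *)
From HB Require Import structures.
From mathcomp Require Import all_boot all_order all_algebra.
From mathcomp Require Import all_classical all_reals all_analysis.
Set Implicit Arguments.
Unset Strict Implicit.
Unset Printing Implicit Defensive.
Import Order.TTheory GRing.Theory Num.Theory.
Import numFieldNormedType.Exports.
Local Open Scope classical_set_scope.
Local Open Scope ring_scope.

(* Countable ordinals, presented by trees: [csup s] denotes the supremum of
   the sequence [s], which need not be increasing.  A given ordinal has many
   presentations, so that [cle] is a total well-founded preorder; equality of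
   ordinals is [cle s t /\ cle t s].  By [countable_below] and [clt_csup] every
   proper initial segment is countable and every countable family is strictly
   bounded, i.e. the order type is omega_1. *)
Inductive cord : Type :=
| czero
| csucc of cord
| csup of nat -> cord.

HB.instance Definition _ := gen_eqMixin cord.
HB.instance Definition _ := gen_choiceMixin cord.

(* The clauses for [csucc s], by recursion on [t], define [s < t]. *)
Fixpoint cle (s : cord) : cord -> Prop :=
  match s with
  | czero => fun=> True
  | csucc s' => fix lt_s' (t : cord) : Prop :=
      match t with
      | czero => False
      | csucc t' => cle s' t'
      | csup g => exists n, lt_s' (g n)
      end
  | csup f => fun t => forall n, cle (f n) t
  end.

Definition clt (s t : cord) : Prop := cle (csucc s) t.

Fixpoint cadd (s t : cord) : cord :=
  match t with
  | czero => s
  | csucc t' => csucc (cadd s t')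
  | csup f => csup (fun n => cadd s (f n))
  end.

Lemma cle_csup s f n : cle s (f n) -> cle s (csup f).
Proof.
elim: s => [|s _|g IH] //=; first by move=> ?; exists n.
by move=> H m; apply: IH.
Qed.

Lemma clexx s : cle s s.
Proof. by elim: s => [|s|f IH] //= n; apply: cle_csup (IH n). Qed.

Lemma cle_trans t s u : cle s t -> cle t u -> cle s u.
Proof.
elim: s t u => [|s IHs|f IH] //=; last first.
  by move=> t u H tu n; apply: IH (H n) tu.
elim=> [|t _|g IH] //= u; last by move=> [n st] /(_ n); apply: IH.
move=> st; elim: u => [|u _|g IH] //=; first exact: IHs st.
by move=> [n /IH ?]; exists n.
Qed.

Lemma cle_succ s : cle s (csucc s).
Proof.
elim: s => [|s|f IH] //= n.
apply: cle_trans (IH n) _.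
exact: (cle_csup (clexx (f n))).
Qed.

Lemma cltW s t : clt s t -> cle s t.
Proof. exact: cle_trans (cle_succ s). Qed.

Lemma cle_total s t : cle s t \/ clt t s.
Proof.
rewrite /clt; elim: s t => [|s IHs|f IH] t /=; first by left.
- elim: t => [|t _|g IH] /=; first by right.
    by have := IHs t.
  have [?|/forallNP H] := pselect (exists n, clt s (g n)); first by left.
  by right=> n; have [/H|] := IH n.
- have [?|/existsNP[n fnt]] := pselect (forall n, cle (f n) t); first by left.
  by right; exists n; have [/fnt|] := IH n t.
Qed.

Lemma clt_wf : well_founded clt.
Proof.
suff H t s : cle s t -> Acc clt s by move=> t; apply: H (clexx t).
elim: t s => [|t IH|f IH] s st; constructor=> u us.
- by have := cle_trans us st.
- exact: IH (cle_trans us st).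
- by have [n un] := cle_trans us st; apply: (IH n); exact: cltW.
Qed.

Lemma clt_irr s : ~ clt s s.
Proof. by elim/(well_founded_ind clt_wf): s => s IH lts; apply: IH (lts) lts. Qed.

Lemma clt_csup (f : nat -> cord) n : clt (f n) (csup (csucc \o f)).
Proof. exact: (cle_csup (clexx (csucc (f n)))). Qed.

Lemma countable_below t : exists e : nat -> cord,
  forall s, clt s t -> exists n, cle s (e n) /\ cle (e n) s.
Proof.
elim: t => [|t [e eP]|f /choice[e eP]]; first by exists (fun=> czero).
- exists (fun n => if n is m.+1 then e m else t) => s st.
  have [ts|/eP[n]] := cle_total t s; first by exists 0%N.
  by exists n.+1.
- exists (fun k => if @unpickle (nat * nat)%type k is Some (n, m)
                   then e n m else czero).
  move=> s [n /(eP n)[m]]; exists (@pickle (nat * nat)%type (n, m)).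
  by rewrite pickleK.
Qed.

(* The ordinals less than or equal to omega_1. *)
Inductive ord : Type := Countable of cord | omega1.

HB.instance Definition _ := gen_eqMixin ord.
HB.instance Definition _ := gen_choiceMixin ord.

Definition ole (a b : ord) : Prop :=
  match a, b with
  | Countable s, Countable t => cle s t
  | _, omega1 => True
  | omega1, Countable _ => False
  end.

(* Ordinal addition with a countable left summand: [s + omega_1 = omega_1]. *)
Definition oadd (s : cord) (b : ord) : ord :=
  if b is Countable t then Countable (cadd s t) else omega1.

Notation "a <=o b" := (ole a b) (at level 70, no associativity).
Notation "s +o b" := (oadd s b) (at level 50, left associativity).

Definition cone : cord := csucc czero.

Definition omin (A : set ord) : ord :=
  xget omega1 [set m | A m /\ forall a, A a -> m <=o a].

Definition osup (A : set ord) : ord :=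
  xget omega1 [set s | (forall a, A a -> a <=o s) /\
                       forall b, (forall a, A a -> a <=o b) -> s <=o b].

Definition cleast (A : set cord) : set cord :=
  [set s | A s /\ forall t, A t -> cle s t].

Lemma cleast_neq0 (A : set cord) : A !=set0 -> cleast A !=set0.
Proof.
move=> [s]; elim/(well_founded_ind clt_wf): s => s IH As.
have [[t [ts At]]|/forallNP H] := pselect (exists t, clt t s /\ A t).
  exact: IH ts At.
exists s; split=> // t At.
by have [//|ts] := cle_total s t; case: (H t).
Qed.

Lemma omin_in (A : set ord) : A !=set0 ->
  A (omin A) /\ forall a, A a -> omin A <=o a.
Proof.
move=> A0; apply: (@xgetPex _ omega1 [set m | A m /\ forall a, A a -> m <=o a]).
have [/cleast_neq0[s [As sP]]|N] := pselect ((A \o Countable) !=set0).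
  by exists (Countable s); split=> // -[t /sP|].
have [[t|] At] := A0; first by exfalso; apply: N; exists t.
by exists omega1; split=> // -[t At'|//]; exfalso; apply: N; exists t.
Qed.

Lemma osup_lub (A : set ord) : (forall a, A a -> a <=o osup A) /\
  forall b, (forall a, A a -> a <=o b) -> osup A <=o b.
Proof.
have [] := @omin_in [set b | forall a, A a -> a <=o b].
  by exists omega1; case.
set m := omin _ => mA mP.
by apply: (@xgetPex _ omega1 [set s | (forall a, A a -> a <=o s) /\
  forall b, (forall a, A a -> a <=o b) -> s <=o b]); exists m.
Qed.

Section Derivatives.
Variable X : topologicalType.
Implicit Types (D : set X -> set X) (F : set X).

Definition derivative D : Prop :=
  [/\ forall F, closed F -> closed (D F),
      forall F, closed F -> D F `<=` F &
      forall A B, closed A -> closed B -> A `<=` B -> D A `<=` D B].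

(* [D ^ eta (F)]; the usual clause at limit ordinals is [diter_limit]. *)
Fixpoint diter D (eta : cord) F : set X :=
  match eta with
  | czero => F
  | csucc theta => D (diter D theta F)
  | csup f => \bigcap_n diter D (f n) F
  end.

Definition rk D : ord :=
  xget omega1
    (Countable @` cleast [set eta | diter D eta [set: X] = set0]).

Lemma closed_diter D F : derivative D -> closed F ->
  forall eta, closed (diter D eta F).
Proof.
move=> [cD _ _] cF; elim=> [|s IH|f IH] //=; first exact: cD.
by apply: closed_bigI => n _; exact: IH.
Qed.

Lemma diter_sub D F : derivative D -> closed F ->
  forall eta, diter D eta F `<=` F.
Proof.
move=> dD cF; elim=> [|s IH|f IH] //=.
  by have [_ sD _] := dD; apply: subset_trans IH; apply: sD; exact: closed_diter.
by move=> x /(_ 0%N Logic.I); exact: IH.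
Qed.

Lemma diter_le D F : derivative D -> closed F ->
  forall s t, cle s t -> diter D t F `<=` diter D s F.
Proof.
move=> dD cF; have [_ _ mD] := dD; elim=> [|s IHs|f IH] /= t.
- by move=> _; exact: diter_sub.
- elim: t => [|t _|g IH] //=.
    by move=> /IHs; apply: mD; exact: closed_diter.
  by move=> [n /IH H] x /(_ n Logic.I) /H.
- by move=> H x tx n _; apply: IH tx.
Qed.

Lemma diter_limit D F eta : derivative D -> closed F ->
  clt czero eta -> (forall theta, clt theta eta -> clt (csucc theta) eta) ->
  diter D eta F = \bigcap_(theta in [set t | clt t eta]) diter D theta F.
Proof.
move=> dD cF eta0 etaS; apply/seteqP; split=> x Hx.
  by move=> t /cltW /(diter_le dD cF); exact.
suff H u : cle u eta -> diter D u F x by exact/H/clexx.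
elim: u => [_|u _ /etaS/Hx|f IH fe n _] //; first exact: Hx eta0.
exact: IH.
Qed.

Lemma rkP D : (exists eta, diter D eta [set: X] = set0) ->
  exists2 eta, rk D = Countable eta &
    cleast [set eta | diter D eta [set: X] = set0] eta.
Proof.
move=> /cleast_neq0[s sP].
have [t tP /esym tE] := @xgetPex _ omega1
  (Countable @` cleast [set eta | diter D eta [set: X] = set0])
  (ex_intro _ _ (ex_intro2 _ _ s sP erefl)).
by exists t.
Qed.

Lemma rkN D : ~ (exists eta, diter D eta [set: X] = set0) -> rk D = omega1.
Proof.
move=> N; rewrite /rk; case: xgetP => // y _ [s [s0 _] _].
by exfalso; apply: N; exists s.
Qed.

End Derivatives.

Section Ranks.
Variables (R : realType) (X : topologicalType).
Implicit Types (f : X -> R) (fn : nat -> X -> R) (x : X) (e : R).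
Implicit Types (A B F U : set X).

Definition polish : Prop :=
  (exists d : X -> X -> R,
    [/\ forall x y, (d x y = 0) <-> (x = y),
        forall x y, d x y = d y x,
        forall x y z, d x z <= d x y + d y z,
        forall x A, nbhs x A <->
          exists2 e, 0 < e & [set y | d x y < e] `<=` A &
        forall u : nat -> X,
          (forall e, 0 < e -> exists N, forall m n,
             (N <= m)%N -> (N <= n)%N -> d (u m) (u n) < e) ->
          exists l : X, u n @[n --> \oo] --> l]) /\
  exists2 S : set X, countable S & dense S.

Definition approximates fn f : Prop :=
  (forall n, continuous (fn n)) /\
  (forall x, fn n x @[n --> \oo] --> f x).

Definition baire1 f : Prop := exists fn, approximates fn f.

Definition D_sep A B F : set X := closure (F `&` A) `&` closure (F `&` B).

Definition alpha f : ord :=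
  osup [set rk (D_sep [set x | f x <= ratr pq.1] [set x | ratr pq.2 <= f x])
       | pq in [set pq : rat * rat | pq.1 < pq.2]].

(* The suprema below are over a nonempty set as soon as [x] belongs to [F],
   the only case in which the oscillations are used. *)
Definition osc f x F : \bar R :=
  ereal_inf [set ereal_sup [set `|f x12.1 - f x12.2|%:E
                           | x12 in (U `&` F) `*` (U `&` F)]
            | U in [set U | open U /\ U x]].

Definition D_osc f e F : set X := [set x | F x /\ (e%:E <= osc f x F)%E].

Definition beta f : ord := osup [set rk (D_osc f e) | e in [set e | 0 < e]].

Definition osc_seq fn x F : \bar R :=
  ereal_inf [set
    ereal_inf [set
      ereal_sup [set z | exists n m y,
        [/\ (N <= n)%N, (N <= m)%N, (U `&` F) y
          & z = `|fn m y - fn n y|%:E]]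
    | N in [set: nat]]
  | U in [set U | open U /\ U x]].

Definition D_osc_seq fn e F : set X :=
  [set x | F x /\ (e%:E <= osc_seq fn x F)%E].

Definition gamma f : ord :=
  omin [set osup [set rk (D_osc_seq fn e) | e in [set e | 0 < e]]
       | fn in [set fn | approximates fn f]].

Lemma derivative_D_sep A B : derivative (D_sep A B).
Proof.
split.
- by move=> F _; apply: closedI; exact: closed_closure.
- by move=> F cF x [Hx _]; apply: cF; apply: closureS Hx => y [].
- by move=> F G _ _ FG; apply: setISS; apply: closureS; exact: setSI.
Qed.

Lemma derivative_D_osc f e : derivative (D_osc f e).
Proof.
split.
- move=> F cF x clx; split; first by apply: cF; apply: closureS clx => y [].
  apply: le_ereal_inf_tmp => _ [U [oU Ux] <-].
  have [y [[Fy ey] Uy]] := clx U (open_nbhs_nbhs (conj oU Ux)).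
  by apply: (le_trans ey); apply: ereal_inf_lbound; exists U.
- by move=> F _ x [].
- move=> F G _ _ FG x [Fx ex]; split; first exact: FG.
  apply: le_ereal_inf_tmp => _ [U UP <-]; apply: (le_trans ex).
  apply: (@le_trans _ _ (ereal_sup [set `|f x12.1 - f x12.2|%:E
                           | x12 in (U `&` F) `*` (U `&` F)])).
    by apply: ereal_inf_lbound; exists U.
  apply: ereal_sup_le; apply: image_subset.
  move=> [a b] /= [[Ua Fa] [Ub Fb]].
  by split; split=> //; exact: FG.
Qed.

Lemma derivative_D_osc_seq fn e : derivative (D_osc_seq fn e).
Proof.
split.
- move=> F cF x clx; split; first by apply: cF; apply: closureS clx => y [].
  apply: le_ereal_inf_tmp => _ [U [oU Ux] <-].
  have [y [[Fy ey] Uy]] := clx U (open_nbhs_nbhs (conj oU Ux)).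
  by apply: (le_trans ey); apply: ereal_inf_lbound; exists U.
- by move=> F _ x [].
- move=> F G _ _ FG x [Fx ex]; split; first exact: FG.
  apply: le_ereal_inf_tmp => _ [U UP <-].
  apply: le_ereal_inf_tmp => _ [N _ <-]; apply: (le_trans ex).
  apply: le_trans (ereal_inf_lbound _) _; first by exists U.
  apply: le_trans (ereal_inf_lbound _) _; first by exists N.
  apply: ereal_sup_le => _ [n [m [y [nN mN [Uy Fy] ->]]]].
  by exists n, m, y; split=> //; split=> //; exact: FG.
Qed.

End Ranks.

(* Main.v *)
(** Off [F] the function [f * 1_F] is locally constant, so one step of any of its
derivatives lands inside [F], where it coincides with [f]; this first step is the
summand [1].  For gamma, approximants [fn] of [f] are replaced by
[fn * max(0, 1 - n d(x, F))], which equal [fn] on [F] and vanish eventually near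
every point outside [F]. *)
Require Import Defs.
From mathcomp Require Import all_boot all_order all_algebra.
From mathcomp Require Import all_classical all_reals all_analysis.
From mathcomp Require Import lra.
Set Implicit Arguments.
Unset Strict Implicit.
Unset Printing Implicit Defensive.
Import Order.TTheory GRing.Theory Num.Theory.
Import numFieldNormedType.Exports.
Local Open Scope classical_set_scope.
Local Open Scope ring_scope.

Lemma cle_addr s t : cle s (Defs.cadd s t).
Proof.
elim: t => [|t IH|g IH] /=; first exact: clexx.
- exact: cle_trans IH (cle_succ _).
- exact: (@cle_csup s (fun n => Defs.cadd s (g n)) 0%N (IH 0%N)).
Qed.

Lemma cle_add2l s t u : cle t u -> cle (Defs.cadd s t) (Defs.cadd s u).
Proof.
elim: t u => [|t IHt|g IH] u /=; first by move=> _; exact: cle_addr.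
- elim: u => [//|u _|h IHh] /=; first exact: IHt.
  by move=> [n /IHh]; exists n.
- by move=> H n; apply: IH.
Qed.

Lemma ole_trans (b a c : ord) : a <=o b -> b <=o c -> a <=o c.
Proof. by case: a b c => [a|] [b|] [c|] //=; exact: cle_trans. Qed.

Lemma ole_add2l s (a b : ord) : a <=o b -> s +o a <=o s +o b.
Proof. by case: a b => [a|] [b|] //=; exact: cle_add2l. Qed.

Lemma osup_le_add (I : Type) (P : set I) (s : cord) (r r' : I -> ord) :
  (forall i, P i -> r i <=o s +o r' i) ->
  osup [set r i | i in P] <=o s +o osup [set r' i | i in P].
Proof.
move=> H; apply: (osup_lub _).2 => _ [i Pi <-].
apply: ole_trans (H i Pi) _; apply: ole_add2l.
by apply: (osup_lub _).1; exists i.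
Qed.

(** Induction on [eta]: [cadd] recurses on its right summand, so the iterate of [D] starts at [D
    [set: X]], which lies in [F]. Each later step stays in [F], where [D] is dominated by [D'], and
    [D'] is monotone. *)
Lemma diter_add1 (X : topologicalType) (D D' : set X -> set X) (F : set X) :
  derivative D -> derivative D' -> D [set: X] `<=` F ->
  (forall H, closed H -> H `<=` F -> D H `<=` D' H) ->
  forall eta, diter D (Defs.cadd cone eta) [set: X]
              `<=` F `&` diter D' eta [set: X].
Proof.
move=> dD dD' DF DD'; have cD := closed_diter dD (@closedT X).
have cD' := closed_diter dD' (@closedT X).
elim=> [x /DF//|s IH|g IH] /= x Dx.
- have [_ subD _] := dD; have [_ _ monD'] := dD'.
  split; first by apply: (IH x _).1; apply: subD Dx.
  apply: (monD' _ _ (cD (Defs.cadd cone s)) (cD' s)).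
    by move=> y /IH[].
  by apply: DD' Dx => // y /IH[].
(* The intersection runs over all of [nat], so index 0 already gives membership in [F]. *)
- split; first exact: (IH 0%N x (Dx 0%N Logic.I)).1.
  by move=> n _; exact: (IH n x (Dx n Logic.I)).2.
Qed.

Lemma rk_add1 (X : topologicalType) (D D' : set X -> set X) (F : set X) :
  derivative D -> derivative D' -> D [set: X] `<=` F ->
  (forall H, closed H -> H `<=` F -> D H `<=` D' H) ->
  rk D <=o cone +o rk D'.
Proof.
move=> dD dD' DF DD'.
(* If no iterate of [D'] is empty, the right side is [omega1], which bounds every rank. *)
have [/rkP[eta -> [eta0 _]]|/rkN->] :=
  pselect (exists eta, diter D' eta [set: X] = set0); last by case: (rk D).
have D0 : diter D (Defs.cadd cone eta) [set: X] = set0.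
  by rewrite -subset0 => x /(diter_add1 dD dD' DF DD')[_]; rewrite eta0.
have [|xi -> [_ le_xi]] := @rkP _ D; first by exists (Defs.cadd cone eta).
exact: le_xi.
Qed.

Section MulIndic.
Context {R : realType} {X : topologicalType}.
Implicit Types (f : X -> R) (F : set X).

Lemma mul_indic_in f F x : F x -> (f \* \1_F) x = f x.
Proof. by move=> Fx; rewrite /= indicE mem_set// mulr1. Qed.

Lemma mul_indic_out f F x : ~ F x -> (f \* \1_F) x = 0.
Proof. by move=> Fx; rewrite /= indicE memNset// mulr0. Qed.

Lemma eq_osc f f' x F : {in F, f =1 f'} -> osc f x F = osc f' x F.
Proof.
move=> ff'; congr ereal_inf; apply: eq_imagel => U _.
congr ereal_sup; apply: eq_imagel => -[a b] [[_ Fa] [_ Fb]] /=.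
by rewrite !ff' ?inE.
Qed.

(** The set [U] itself witnesses the bound. Only an inequality holds: if [U] misses [F], the
    supremum is over the empty set and equals minus infinity. *)
Lemma osc_const_le0 f c x U F : open U -> U x -> (forall y, U y -> f y = c) ->
  (osc f x F <= 0)%E.
Proof.
move=> oU Ux fc; apply: le_trans (ereal_inf_lbound _) _; first by exists U.
apply: ge_ereal_sup => _ [[a b] [[Ua _] [Ub _]] <-] /=.
by rewrite !fc// subrr normr0.
Qed.

Lemma eq_osc_seq (fn gn : nat -> X -> R) x F :
  (forall n, {in F, fn n =1 gn n}) -> osc_seq fn x F = osc_seq gn x F.
Proof.
move=> fg; congr ereal_inf; apply: eq_imagel => U _.
congr ereal_inf; apply: eq_imagel => N _.
congr ereal_sup; apply/seteqP; split=> _ [n [m [y [nN mN [Uy Fy] ->]]]].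
  by exists n, m, y; split=> //; rewrite !fg ?inE.
by exists n, m, y; split=> //; rewrite !fg ?inE.
Qed.

Lemma osc_seq_const_le0 (fn : nat -> X -> R) c x U N F : open U -> U x ->
  (forall n y, (N <= n)%N -> U y -> fn n y = c) -> (osc_seq fn x F <= 0)%E.
Proof.
move=> oU Ux fc; apply: le_trans (ereal_inf_lbound _) _; first by exists U.
apply: le_trans (ereal_inf_lbound _) _; first by exists N.
apply: ge_ereal_sup => _ [n [m [y [nN mN [Uy _] ->]]]].
by rewrite !fc// subrr normr0.
Qed.

(** Near a point outside [F] the product is 0. If that point were in both closures, then [0 <= p]
    and [q <= 0], against [p < q]. *)
Lemma rk_D_sep_mul_indic f F (p q : R) : closed F -> p < q ->
  rk (D_sep [set x | (f \* \1_F) x <= p] [set x | q <= (f \* \1_F) x])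
  <=o cone +o rk (D_sep [set x | f x <= p] [set x | q <= f x]).
Proof.
move=> cF pq; apply: (@rk_add1 _ _ _ F); try exact: derivative_D_sep.
- move=> x [clp clq]; apply: contrapT => Fx.
  have nFx : nbhs x (~` F) by apply: open_nbhs_nbhs; split=> //; exact: closed_openC.
  have [y [[_ /= yp] Fy]] := clp _ nFx; have [z [[_ /= zq] Fz]] := clq _ nFx.
  move: yp zq; rewrite !indicE !memNset// !mulr0 => p0 q0.
  by have := lt_le_trans pq (le_trans q0 p0); rewrite ltxx.
- move=> H _ HF; apply: setISS; apply: closureS => x [Hx /=];
    by rewrite indicE mem_set ?mulr1//; exact: HF.
Qed.

Lemma rk_D_osc_mul_indic f F (e : R) : closed F -> 0 < e ->
  rk (D_osc (f \* \1_F) e) <=o cone +o rk (D_osc f e).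
Proof.
move=> cF e0; apply: (@rk_add1 _ _ _ F); try exact: derivative_D_osc.
- move=> x [_ ex]; apply: contrapT => Fx.
  have := le_trans ex (osc_const_le0 _ (closed_openC cF) Fx
    (@mul_indic_out f F)).
  by rewrite lee_fin leNgt e0.
- move=> H _ HF x [Hx ex]; split=> //; rewrite (@eq_osc f (f \* \1_F))//.
  by move=> y /set_mem/HF/mul_indic_in->.
Qed.

(** The index [N] is uniform on the neighbourhood [U]: eventual vanishing at each single point would
    give pointwise convergence but would not control [osc_seq]. *)
Definition cutoff F (phi : nat -> X -> R) : Prop :=
  [/\ forall n, continuous (phi n), forall n x, F x -> phi n x = 1 &
      forall x, ~ F x -> exists U N,
        [/\ open U, U x & forall n y, (N <= n)%N -> U y -> phi n y = 0]].

Lemma cutoff_mul_approximates F phi (fn : nat -> X -> R) f :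
  cutoff F phi -> approximates fn f ->
  approximates (fun n => fn n \* phi n) (f \* \1_F).
Proof.
move=> [cphi phi1 phi0] [cfn fnf]; split=> [n x|x].
  by apply: cvgM; [exact: cfn|exact: cphi].
have [Fx|Fx] := pselect (F x).
  rewrite mul_indic_in//; apply: cvg_trans (fnf x); apply: near_eq_cvg.
  by near=> n; rewrite /= phi1// mulr1.
rewrite mul_indic_out//; have [U [N [_ Ux UN]]] := phi0 x Fx.
apply: cvg_near_cst; exists N => // n /= Nn.
by rewrite (UN n x)// mulr0.
Unshelve. all: by end_near. Qed.

(** Outside [F] a whole tail of the products vanishes on a neighbourhood, so the oscillation there
    is below [e]; on [F] the products are the [fn n]. *)
Lemma rk_D_osc_seq_cutoff F phi (fn : nat -> X -> R) (e : R) :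
  cutoff F phi -> 0 < e ->
  rk (D_osc_seq (fun n => fn n \* phi n) e) <=o cone +o rk (D_osc_seq fn e).
Proof.
move=> [_ phi1 phi0] e0; apply: (@rk_add1 _ _ _ F);
  try exact: derivative_D_osc_seq.
- move=> x [_ ex]; apply: contrapT => /phi0[U [N [oU Ux UN]]].
  have UN0 n y : (N <= n)%N -> U y -> (fn n \* phi n) y = 0.
    by move=> Nn Uy; rewrite /= (UN n y)// mulr0.
  have := le_trans ex (osc_seq_const_le0 _ oU Ux UN0).
  by rewrite lee_fin leNgt e0.
- move=> H _ HF x [Hx ex]; split=> //.
  rewrite (@eq_osc_seq fn (fun n => fn n \* phi n))// => n y /set_mem/HF Fy.
  by rewrite /= phi1// mulr1.
Qed.

Lemma metric_cutoff (d : X -> X -> R) F :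
  (forall x y, d x y = 0 <-> x = y) ->
  (forall x y, d x y = d y x) ->
  (forall x y z, d x z <= d x y + d y z) ->
  (forall x A, nbhs x A <-> exists2 e, 0 < e & [set y | d x y < e] `<=` A) ->
  closed F -> exists phi, cutoff F phi.
Proof.
move=> d0 dC dT dN cF.
have dge0 x y : 0 <= d x y.
  by have := dT x y x; rewrite (dC y x) (proj2 (d0 x x) erefl); lra.
(* The infimum of the empty set defaults to 0, which would make the cutoff functions constantly 1;
   for empty [F] the zero sequence is taken instead. *)
have [->|/set0P[a Fa]] := eqVneq F set0.
  exists (fun _ _ => 0); split=> // [n x|x _]; first exact: cst_continuous.
  by exists setT, 0%N; split=> //; exact: openT.
pose r x := inf [set d x y | y in F].
have has_inf_d x : has_inf [set d x y | y in F].
  by split; [exists (d x a), a|exists 0 => _ [y _ <-]].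
have r_le x y : F y -> r x <= d x y.
  by move=> Fy; apply: ge_inf; [exact: (has_inf_d x).2|exists y].
have r_ge x c : (forall y, F y -> c <= d x y) -> c <= r x.
  move=> H; apply: lb_le_inf; first exact: (has_inf_d x).1.
  by move=> _ [y Fy <-]; exact: H.
(* The distance [r] to [F] is 1-Lipschitz; continuity uses this bound in both directions. *)
have r_lip x y : r x - d x y <= r y.
  by apply: r_ge => z Fz; have := r_le x z Fz; have := dT x y z; lra.
have r_cont : continuous r.
  move=> x; apply/cvgrPdist_lt => e e0; apply/dN; exists e => // y /= dxy.
  have := r_lip x y; have := r_lip y x; rewrite (dC y x) => *.
  by rewrite ltr_norml; lra.
exists (fun n x => Num.max 0 (1 - n%:R * r x)); split=> [n x|n x Fx|x Fx].
- apply: (@continuous_max _ _ (cst 0) (fun x => 1 - n%:R * r x)).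
    exact: cst_continuous.
  by apply: cvgB; [exact: cvg_cst|apply: cvgM; [exact: cvg_cst|exact: r_cont]].
- have -> : r x = 0.
    apply/eqP; rewrite eq_le r_ge// andbT.
    by have := r_le x x Fx; rewrite (proj2 (d0 x x) erefl).
  by rewrite mulr0 subr0 max_r.
- have /dN[e e0 eF] : nbhs x (~` F).
    by apply: open_nbhs_nbhs; split=> //; exact: closed_openC.
  (* The ball of radius [e] about [x] misses [F]. *)
  have rx : e <= r x.
    by apply: r_ge => y Fy; rewrite leNgt; apply/negP => /eF.
  (* Halving [e] makes [U] an open neighbourhood of [x]. The index exceeds [2 / e], so from there on
     [n%:R * r y] is at least [2 / e * (e / 2) = 1] on [U] and the maximum is 0. *)
  exists [set y | e / 2 < r y], (Num.truncn (2 / e)).+1; split.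
  + apply: (@open_comp _ _ r [set t | e / 2 < t]); last exact: open_gt.
    by move=> ? _; exact: r_cont.
  + by rewrite /=; lra.
  + move=> n y Nn /= ry; apply/max_idPl; rewrite subr_le0.
    have ne : 2 / e <= n%:R.
      apply: le_trans (_ : (Num.truncn (2 / e)).+1%:R <= _); last by rewrite ler_nat.
      exact/ltW/truncnS_gt.
    apply: le_trans (_ : 2 / e * (e / 2) <= _).
      by rewrite mulrA divfK ?gt_eqF// divff.
    by apply: ler_pM => //; [rewrite divr_ge0// ltW|rewrite divr_ge0// ltW|exact: ltW].
Qed.

End MulIndic.

Theorem theorem3p28 (R : realType) (X : topologicalType) (f : X -> R)
    (F : set X) :
  polish R X -> ~ countable [set: X] -> baire1 f -> closed F ->
  [/\ alpha (f \* \1_F) <=o cone +o alpha f,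
      beta (f \* \1_F) <=o cone +o beta f &
      gamma (f \* \1_F) <=o cone +o gamma f].
Proof.
move=> [[d [d0 dC dT dN _]] _] _ [fn0 fn0f] cF; split.
- apply: osup_le_add => -[p q] /= pq.
  by apply: rk_D_sep_mul_indic; rewrite ?ltr_rat.
- by apply: osup_le_add => e; exact: rk_D_osc_mul_indic.
- have [phi phiP] := metric_cutoff d0 dC dT dN cF.
  (* The minimum defining [gamma f] is attained at some [fn], since [fn0] makes the set of
     candidates nonempty. Its cut-off version is then one competitor in the minimum for the
     product. *)
  have [|[fn fnf fnE] _] :=
    omin_in (A := [set osup [set rk (D_osc_seq fn e) | e in [set e | 0 < e]]
                 | fn in [set fn | approximates fn f]]).
    by eexists; exists fn0.
  have gnP := cutoff_mul_approximates phiP fnf.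
  rewrite {2}/gamma -fnE.
  apply: (ole_trans _ (@osup_le_add _ _ cone _ _
    (fun e => rk_D_osc_seq_cutoff fn phiP))).
  apply: (omin_in _).2; last by exists (fun n => fn n \* phi n).
  by eexists; exists (fun n => fn n \* phi n).
Qed.
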